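(* Let $\mathcal{R} = \langle \Sigma, \mathcal{I}, \mathcal{T}\rangle$ be a regular transition system. For every $b\geq 1$, the set of configurations $\mathit{IndInv}_b$ is effectively regular: it is a regular language, and a finite automaton recognizing it can be computed from $\mathcal{R}$ and $b$.
   Context: All alphabets are finite. For words $w, u \in \Sigma^*$ of the same length $\ell$, $\langle w,u\rangle$ denotes the word $\langle w[1],u[1]\rangle \cdots \langle w[\ell],u[\ell]\rangle \in (\Sigma\times\Sigma)^*$. A (length-preserving) transducer over $\Sigma\times\Sigma$ is an NFA over the alphabet $\Sigma \times \Sigma$. A regular transition system (RTS) is a triple $\langle \Sigma, \mathcal{I}, \mathcal{T}\rangle$ with $\Sigma$ an alphabet, $\mathcal{I}$ an NFA over $\Sigma$, and $\mathcal{T}$ a transducer over $\Sigma\times\Sigma$. Words over $\Sigma$ are configurations; those accepted by $\mathcal{I}$ are initial; $w \leadsto u$ means that $|w|=|u|$ and $\langle w,u\rangle$ is accepted by $\mathcal{T}$. A set $S\subseteq\Sigma^*$ is inductive if $w\in S$ and $w\leadsto u$ imply $u\in S$. For $\ell\ge 0$, $\mathit{AP}_\ell$ is the set of atomic propositions $q_{j:\ell}$ with $q\in\Sigma$, $j\in[1,\ell]$. A formula over $\mathit{AP}_\ell$ is a positive Boolean formula in conjunctive normal form over $\mathit{AP}_\ell$ and the constants $\mathit{true}$, $\mathit{false}$ (an empty clause is $\mathit{false}$). A configuration of length $\ell$ satisfies $q_{j:\ell}$ iff its $j$-th letter is $q$, with the usual extension to Boolean combinations; every configuration of length different from $\ell$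 satisfies every formula over $\mathit{AP}_\ell$. A formula is inductive if the set of configurations satisfying it is inductive. A $b$-formula is a formula with at most $b$ clauses ($\mathit{true}$ being the only formula with $0$ clauses). For configurations $u,w$, write $u \stackrel{*}{\leadsto}_b w$ if every inductive $b$-formula (over any $\mathit{AP}_\ell$) satisfied by $u$ is also satisfied by $w$. Let $\mathit{IndInv}_b = \{w\in\Sigma^*\mid u \stackrel{*}{\leadsto}_b w \text{ for some initial configuration } u\}$. *)

(* Defs.v *)
From mathcomp Require Import all_boot.

Set Implicit Arguments.
Unset Strict Implicit.
Unset Printing Implicit Defensive.

Record nfa (A : finType) := Nfa {
  nfa_state : finType;
  nfa_init : {set nfa_state};
  nfa_final : {set nfa_state};
  nfa_trans : nfa_state -> A -> nfa_state -> bool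
}.

Fixpoint nfa_run (A : finType) (M : nfa A) (p : nfa_state M) (w : seq A) : bool :=
  if w is a :: w' then [exists q, nfa_trans p a q && nfa_run q w']
  else p \in nfa_final M.

Definition nfa_accepts (A : finType) (M : nfa A) (w : seq A) : bool :=
  [exists p in nfa_init M, nfa_run p w].

Record rts (Sigma : finType) := Rts {
  rts_init : nfa Sigma;
  rts_trans : nfa (Sigma * Sigma)%type
}.

(* The test on sizes is needed because zip truncates the longer word. *)
Definition rts_step (Sigma : finType) (R : rts Sigma) (w u : seq Sigma) : bool :=
  (size w == size u) && nfa_accepts (rts_trans R) (zip w u).

Definition inductive_set (Sigma : finType) (R : rts Sigma) (S : pred (seq Sigma)) : Prop :=
  forall w u, S w -> rts_step R w u -> S u.

(* Atom l q j is the proposition q_{j+1:l}: positions are numbered from 0. *)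
Inductive literal (Sigma : finType) (l : nat) : Type :=
| Atom (q : Sigma) (j : 'I_l)
| Const (c : bool).

Definition clause (Sigma : finType) (l : nat) := seq (literal Sigma l).
Definition formula (Sigma : finType) (l : nat) := seq (clause Sigma l).

Definition sat_literal (Sigma : finType) (l : nat) (w : seq Sigma)
    (x : literal Sigma l) : bool :=
  match x with
  | Atom q j => onth w j == Some q
  | Const c => c
  end.

Definition sat (Sigma : finType) (l : nat) (phi : formula Sigma l) (w : seq Sigma) : bool :=
  (size w == l) ==> all (fun c : clause Sigma l => has (sat_literal w) c) phi.

Definition inductive_formula (Sigma : finType) (R : rts Sigma) (l : nat)
    (phi : formula Sigma l) : Prop :=
  inductive_set R (sat phi).

(* u ~>*_b w *)
Definition potentially_reachable (Sigma : finType) (R : rts Sigma) (b : nat)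
    (u w : seq Sigma) : Prop :=
  forall (l : nat) (phi : formula Sigma l),
    size phi <= b -> inductive_formula R phi -> sat phi u -> sat phi w.

Definition IndInv (Sigma : finType) (R : rts Sigma) (b : nat) (w : seq Sigma) : Prop :=
  exists u, nfa_accepts (rts_init R) u /\ potentially_reachable R b u w.

(* Total recursive functions of n arguments: the least class containing zero,
   successor and projections, and closed under composition, primitive recursion
   and minimization of regular functions. Each clause is given by its defining
   equations, so that the class is closed under pointwise equality. *)
Inductive recursive : forall n : nat, (n.-tuple nat -> nat) -> Prop :=
| recursive_zero n (f : n.-tuple nat -> nat) :
    (forall v, f v = 0) -> recursive f
| recursive_succ (f : 1.-tuple nat -> nat) :
    (forall v, f v = (thead v).+1) -> recursive f
| recursive_proj n (i : 'I_n) (f : n.-tuple nat -> nat) :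
    (forall v, f v = tnth v i) -> recursive f
| recursive_comp m n (g : m.-tuple nat -> nat) (h : 'I_m -> n.-tuple nat -> nat)
    (f : n.-tuple nat -> nat) :
    recursive g -> (forall i, recursive (h i)) ->
    (forall v, f v = g [tuple h i v | i < m]) -> recursive f
| recursive_prec n (g : n.-tuple nat -> nat) (h : n.+2.-tuple nat -> nat)
    (f : n.+1.-tuple nat -> nat) :
    recursive g -> recursive h ->
    (forall v : n.-tuple nat, f [tuple of 0 :: v] = g v) ->
    (forall k (v : n.-tuple nat), f [tuple of k.+1 :: v]
                 = h [tuple of k :: f [tuple of k :: v] :: v]) ->
    recursive f
| recursive_min n (g : n.+1.-tuple nat -> nat) (f : n.-tuple nat -> nat) :
    recursive g ->
    (forall v : n.-tuple nat, g [tuple of f v :: v] = 0) ->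
    (forall (v : n.-tuple nat) k, k < f v -> g [tuple of k :: v] <> 0) ->
    recursive f.

(* Goedel numbers. CodeSeq.code is the bijection from seq nat to nat given by
   code [::] = 0 and code (n :: s) = 2 ^ n * (2 * code s + 1).
   States and letters are numbered by their rank in the enumeration of their
   type; in Sigma * Sigma this is the lexicographic order. An automaton is
   represented by its number of states, the characteristic sequences of its
   initial and final states, and its transition table. Given the alphabet, this
   determines the automaton up to renaming of states. *)
Definition code_bits (T : finType) (P : pred T) : nat :=
  CodeSeq.code [seq nat_of_bool (P x) | x <- enum T].

Definition nfa_code (A : finType) (M : nfa A) : nat :=
  CodeSeq.code
    [:: #|nfa_state M|;
        code_bits (mem (nfa_init M));
        code_bits (mem (nfa_final M));
        CodeSeq.code
          [seq CodeSeq.code [seq code_bits (nfa_trans p a) | a <- enum A]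
          | p <- enum (nfa_state M)]].

Definition rts_code (Sigma : finType) (R : rts Sigma) : nat :=
  CodeSeq.code [:: #|Sigma|; nfa_code (rts_init R); nfa_code (rts_trans R)].

(* Main.v *)
(** A formula over AP_l with at most b clauses is, up to equivalence, a word of
    length l whose j-th letter is the set of pairs (clause, letter) occurring at
    position j; since clauses are disjunctions, an automaton can guess a clause
    and check that no position satisfies it. Hence "the configuration satisfies
    the formula" is a regular relation, "the formula is not inductive" is the
    projection of a regular relation, and so is "some inductive formula
    separates u from w". The relation u ~>*_b w is the complement of the latter,
    and IndInv_b is its image of the initial configurations. All these steps are
    products, subset constructions and letter relabellings.

    For effectivity the constructions are carried out on automata whose states
    and letters are natural numbers and whose components are numerical
    predicates; each construction preserves recursiveness in the Goedel number
    of the transition system and in b. *)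
Require Import Defs.
From mathcomp Require Import all_boot.

Set Implicit Arguments.
Unset Strict Implicit.
Unset Printing Implicit Defensive.

(** * Recursive functions *)

(** Composing [f] with all projections reproduces its values, and the composition clause accepts any
    function with these values. *)
Lemma recursive_ext n (f g : n.-tuple nat -> nat) :
  f =1 g -> recursive f -> recursive g.
Proof.
move=> fg rf.
apply: (recursive_comp (g := f) (h := fun i v => tnth v i)) => // [i|v].
  exact: (recursive_proj (i := i)).
rewrite -fg; congr f; apply: eq_from_tnth => i; by rewrite tnth_mktuple.
Qed.

(* Stating computability at every arity at once lets a bound variable be pushed
   in front of the environment; variables out of range read 0. *)
Definition computable (F : seq nat -> nat) : Prop :=
  forall n, recursive (fun v : n.-tuple nat => F v).

Definition computableb (P : seq nat -> bool) : Prop :=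
  computable (fun e => nat_of_bool (P e)).

Lemma computable_ext F G : F =1 G -> computable F -> computable G.
Proof. by move=> FG cF n; apply: recursive_ext (cF n) => v; rewrite FG. Qed.

Lemma computableb_ext P Q : P =1 Q -> computableb P -> computableb Q.
Proof. by move=> PQ; apply: computable_ext => e; rewrite PQ. Qed.

Lemma computable_nth i : computable (fun e => nth 0 e i).
Proof.
move=> n; case: (ltnP i n) => [lt_in|le_ni].
  by apply: (recursive_proj (i := Ordinal lt_in)) => v; rewrite (tnth_nth 0).
by apply: recursive_zero => v; rewrite nth_default // size_tuple.
Qed.

Lemma computable_head : computable (fun e => head 0 e).
Proof.
by apply: computable_ext (computable_nth 0) => e; rewrite nth0.
Qed.

(** The length of the new environment depends only on that of the old one, so at each arity this is
    an ordinary composition. *)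
Lemma computable_subst F (h : nat -> seq nat -> nat) (g : nat -> nat) :
  computable F -> (forall i, computable (h i)) ->
  computable (fun e => F (mkseq (h^~ e) (g (size e)))).
Proof.
move=> cF ch n.
apply: (recursive_comp (g := fun v : (g n).-tuple nat => F v)
  (h := fun i v => h i v)) => // [i|v]; first exact: ch.
congr F; apply: (@eq_from_nth _ 0); rewrite size_mkseq ?size_tuple // => i lt_i.
by rewrite nth_mkseq // -[RHS](tnth_nth 0 _ (Ordinal lt_i)) tnth_mktuple.
Qed.

Lemma computable_behead F : computable F -> computable (fun e => F (behead e)).
Proof.
move=> cF; apply: computable_ext
  (computable_subst (h := fun i e => nth 0 e i.+1) predn cF _) => [e|i].
  congr F; apply: (@eq_from_nth _ 0); rewrite size_mkseq ?size_behead // => i lt_i.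
  by rewrite nth_mkseq // nth_behead.
exact: computable_nth.
Qed.

Lemma computable_behead2 F :
  computable F -> computable (fun e => F (behead (behead e))).
Proof.
move=> cF; apply: (computable_behead (F := fun e => F (behead e))).
exact: computable_behead.
Qed.

Lemma computable_behead3 F :
  computable F -> computable (fun e => F (behead (behead (behead e)))).
Proof.
move=> cF; apply: (computable_behead (F := fun e => F (behead (behead e)))).
exact: computable_behead2.
Qed.

Lemma computable_zero : computable (fun => 0).
Proof. by move=> n; apply: recursive_zero. Qed.

Lemma computable_succ F : computable F -> computable (fun e => (F e).+1).
Proof.
move=> cF n.
apply: (recursive_comp (g := fun v : 1.-tuple nat => (thead v).+1)
  (h := fun _ v => F v)) => // [|v]; first exact: recursive_succ.
by rewrite /thead tnth_mktuple.
Qed.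

Lemma computable_const k : computable (fun => k).
Proof.
by elim: k => [|k IHk]; [exact: computable_zero | exact: computable_succ].
Qed.

(** Primitive recursion with parameters: the step sees the counter, then the previous value, then
    the parameters, in the order of [recursive_prec]. *)
Lemma computable_iteri M H G :
  computable M -> computable G ->
  computable (fun e => H (behead (behead e)) (head 0 e) (head 0 (behead e))) ->
  computable (fun e => iteri (M e) (H e) (G e)).
Proof.
move=> cM cG cH n.
pose P (v : n.+1.-tuple nat) := iteri (thead v) (H (behead v)) (G (behead v)).
have rP : recursive P.
  by apply: recursive_prec (cG n) (cH n.+2) _ _ => [v|k v]; rewrite /P /=.
(* The bound [M v] is put in front of the environment: [unlift ord0] is [None] exactly at index
   0. *)
apply: (recursive_comp (g := P)
  (h := fun i v => if unlift ord0 i is Some j then tnth v j else M v)) => // [i|v].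
  case: unliftP => [j|] _; last exact: cM.
  exact: (recursive_proj (i := j)).
set t := mktuple _; rewrite /P.
have -> : thead t = M v by rewrite /thead tnth_mktuple unlift_none.
have -> // : behead t = v.
have -> : behead t = behead_tuple t by [].
congr val; apply: eq_from_tnth => i.
by rewrite tnth_behead tnth_mktuple -(_ : lift ord0 i = inord i.+1) ?liftK //;
   apply/val_inj; rewrite /= inordK // ltnS.
Qed.

#[local] Hint Resolve computable_head computable_behead : computable.
#[local] Hint Resolve computable_behead2 computable_behead3 : computable.
#[local] Hint Resolve computable_succ computable_const : computable.

(** * Arithmetic, Boolean connectives and bounded quantifiers *)

Lemma computable_add F G :
  computable F -> computable G -> computable (fun e => F e + G e).
Proof.
move=> cF cG.
apply: (@computable_ext (fun e => iteri (F e) (fun _ r => r.+1) (G e))) => [e|].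
  by elim: (F e) => //= m ->.
by apply: computable_iteri; auto with computable.
Qed.

Lemma computable_mul F G :
  computable F -> computable G -> computable (fun e => F e * G e).
Proof.
move=> cF cG.
apply: (@computable_ext (fun e => iteri (F e) (fun _ r => G e + r) 0)) => [e|].
  by elim: (F e) => //= m ->; rewrite mulSn.
apply: computable_iteri; auto with computable.
by apply: computable_add; auto with computable.
Qed.

Lemma computable_exp F G :
  computable F -> computable G -> computable (fun e => F e ^ G e).
Proof.
move=> cF cG.
apply: (@computable_ext (fun e => iteri (G e) (fun _ r => F e * r) 1)) => [e|].
  by elim: (G e) => //= m ->; rewrite expnS.
apply: computable_iteri; auto with computable.
by apply: computable_mul; auto with computable.
Qed.

Lemma computable_pred F : computable F -> computable (fun e => (F e).-1).
Proof.
move=> cF.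
apply: (@computable_ext (fun e => iteri (F e) (fun k _ => k) 0)) => [e|].
  by case: (F e).
by apply: computable_iteri; auto with computable.
Qed.

Lemma computable_sub F G :
  computable F -> computable G -> computable (fun e => F e - G e).
Proof.
move=> cF cG.
apply: (@computable_ext (fun e => iteri (G e) (fun _ r => r.-1) (F e))) => [e|].
  by elim: (G e) => [|m /= ->]; rewrite ?subn0 // subnS.
apply: computable_iteri; auto with computable.
by apply: computable_pred; auto with computable.
Qed.

Lemma computableb_not P : computableb P -> computableb (fun e => ~~ P e).
Proof.
move=> cP; apply: (@computable_ext (fun e => 1 - P e)) => [e|].
  by case: (P e).
by apply: computable_sub; auto with computable.
Qed.

Lemma computableb_and P Q :
  computableb P -> computableb Q -> computableb (fun e => P e && Q e).
Proof.
move=> cP cQ; apply: (@computable_ext (fun e => P e * Q e)) => [e|].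
  by case: (P e); case: (Q e).
exact: computable_mul.
Qed.

Lemma computableb_leq F G :
  computable F -> computable G -> computableb (fun e => F e <= G e).
Proof.
move=> cF cG; apply: (@computable_ext (fun e => 1 - (F e - G e))) => [e|].
  by rewrite /leq; case: (F e - G e).
by do 2![apply: computable_sub; auto with computable].
Qed.

Lemma computableb_eqn F G :
  computable F -> computable G -> computableb (fun e => F e == G e).
Proof.
move=> cF cG; apply: (@computableb_ext (fun e => (F e <= G e) && (G e <= F e))) => [e|].
  by rewrite -eqn_leq.
by apply: computableb_and; apply: computableb_leq.
Qed.

Lemma computableb_eqb P Q :
  computableb P -> computableb Q -> computableb (fun e => P e == Q e).
Proof.
move=> cP cQ; apply: (@computableb_ext (fun e => P e == Q e :> nat)) => [e|].
  by case: (P e); case: (Q e).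
exact: computableb_eqn.
Qed.

(** Inside [computable_iteri] two variables precede the parameters; here they give way to the single
    value [M e], so that a function with one bound variable can be called there. *)
Lemma computable_subst_head P M :
  computable (fun e => P (behead e) (head 0 e)) -> computable M ->
  computable (fun e => P (behead (behead e)) (M e)).
Proof.
move=> cP cM.
pose h i e := if i is 0 then M e else nth 0 e i.+1.
have ch i : computable (h i).
  by case: i => [|i]; [exact: cM | exact: computable_nth].
apply: computable_ext (computable_subst (fun n => n.-2.+1) cP ch) => e.
rewrite /=; congr P; apply: (@eq_from_nth _ 0).
  by rewrite size_map size_iota !size_behead.
move=> i; rewrite size_map size_iota => lt_i.
by rewrite (nth_map 0) ?size_iota // nth_iota // !nth_behead.
Qed.

Lemma computable_count P N :
  computable N -> computableb (fun e => P (behead e) (head 0 e)) ->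
  computable (fun e => count (P e) (iota 0 (N e))).
Proof.
move=> cN cP.
apply: (@computable_ext (fun e => iteri (N e) (fun k r => r + P e k) 0)) => [e|].
  elim: (N e) => // m IHm; rewrite [LHS]/= {}IHm.
  by rewrite -addn1 iotaD count_cat /= addn0.
apply: computable_iteri; auto with computable.
apply: computable_add; first by auto with computable.
by apply: (computable_subst_head (P := fun e k => P e k)); auto with computable.
Qed.

Lemma computableb_has P N :
  computable N -> computableb (fun e => P (behead e) (head 0 e)) ->
  computableb (fun e => has (P e) (iota 0 (N e))).
Proof.
move=> cN cP.
apply: (@computableb_ext (fun e => 0 < count (P e) (iota 0 (N e)))) => [e|].
  by rewrite has_count.
by apply: computableb_leq; [auto with computable | apply: computable_count].
Qed.

Lemma computableb_all P N :
  computable N -> computableb (fun e => P (behead e) (head 0 e)) ->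
  computableb (fun e => all (P e) (iota 0 (N e))).
Proof.
move=> cN cP.
apply: (@computableb_ext (fun e => ~~ has (fun k => ~~ P e k) (iota 0 (N e)))) => [e|].
  by rewrite -all_predC; apply: eq_all => k /=; rewrite negbK.
by apply: computableb_not; apply: computableb_has => //; apply: computableb_not.
Qed.

#[local] Hint Resolve computable_add computable_mul computable_exp computable_sub : computable.
#[local] Hint Resolve computableb_not computableb_and : computable.
#[local] Hint Resolve computableb_leq computableb_eqn computableb_eqb : computable.

(** Replaces bounded minimization: quotients and exponents of 2 are obtained by counting an initial
    segment. *)
Lemma count_initial P n m :
  m <= n -> (forall k, k < n -> P k = (k < m)) -> count P (iota 0 n) = m.
Proof.
move=> le_mn Pm; rewrite (eq_in_count (a2 := fun k => k < m)); last first.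
  by move=> k; rewrite mem_iota => /Pm.
rewrite -(subnKC le_mn) iotaD count_cat add0n.
rewrite (eqP (_ : count (fun k => k < m) (iota 0 m) == m)); last first.
  by rewrite -{3}(size_iota 0 m) -all_count; apply/allP => k; rewrite mem_iota.
rewrite (eq_in_count (a2 := pred0)) ?count_pred0 ?addn0 // => k.
by rewrite mem_iota => /andP[/leq_gtF].
Qed.

Lemma computable_div F G :
  computable F -> computable G -> computable (fun e => F e %/ G e).
Proof.
move=> cF cG; pose P e k := (0 < G e) && (k.+1 * G e <= F e).
apply: (@computable_ext (fun e => count (P e) (iota 0 (F e)))) => [e|].
  apply: count_initial => [|k _]; first exact: leq_div.
  rewrite /P; case: (posnP (G e)) => [->|G_gt0]; first by rewrite divn0.
  by rewrite -leq_divRL.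
by apply: computable_count => //; rewrite /P; auto 6 with computable.
Qed.
#[local] Hint Resolve computable_div : computable.

Lemma computable_mod F G :
  computable F -> computable G -> computable (fun e => F e %% G e).
Proof.
move=> cF cG; apply: (@computable_ext (fun e => F e - F e %/ G e * G e)) => [e|].
  by rewrite {1}(divn_eq (F e) (G e)) addKn.
by auto with computable.
Qed.
#[local] Hint Resolve computable_mod : computable.

(** * Binary digits as finite sets, and access to coded sequences *)

Definition bit q E := (E %/ 2 ^ q) %% 2 == 1.

Lemma computableb_bit F G :
  computable F -> computable G -> computableb (fun e => bit (F e) (G e)).
Proof. by move=> cF cG; rewrite /bit; auto 6 with computable. Qed.

Lemma bit_surj N (P : pred nat) :
  exists2 E, E < 2 ^ N & forall q, q < N -> bit q E = P q.
Proof.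
elim: N => [|N [E ltE bitE]]; first by exists 0.
exists (E + P N * 2 ^ N) => [|q].
  by rewrite expnS mul2n -addnn; case: (P N); rewrite ?mul1n ?ltn_add2r // addn0 ltn_addr.
rewrite ltnS leq_eqVlt => /predU1P[->|lt_qN].
  by rewrite /bit addnC divnMDl ?expn_gt0 // divn_small // addn0; case: (P N).
rewrite -(bitE q) // /bit addnC.
(* Adding [2 ^ N] changes the quotient by [2 ^ q] by an even number, so the lower digits are
   kept. *)
have -> : 2 ^ N = 2 ^ (N - q.+1) * 2 * 2 ^ q
  by rewrite -expnSr -expnD -subSn // subSS subnK // ltnW.
by rewrite mulnA divnMDl ?expn_gt0 // mulnA modnMDl.
Qed.

Definition get v i := nth 0 (CodeSeq.decode v) i.

Lemma get_code s i : get (CodeSeq.code s) i = nth 0 s i.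
Proof. by rewrite /get CodeSeq.codeK. Qed.

Lemma computable_get F G :
  computable F -> computable G -> computable (fun e => get (F e) (G e)).
Proof.
move=> cF cG.
(* The head of a coded sequence is the exponent of 2 in its code. Both [hd] and [tl] send 0, the
   code of the empty sequence, to 0, which is the default value of [get]. *)
pose hd v := count (fun k => v %% 2 ^ k.+1 == 0) (iota 0 v).
pose tl v := v %/ 2 ^ hd v %/ 2.
have hdE n s : hd (CodeSeq.code (n :: s)) = n.
  rewrite /hd /=; set c := CodeSeq.code s.
  apply: count_initial => [|k _].
    by rewrite (leq_trans (ltnW (ltn_expl n (isT : 1 < 2)))) // leq_pmulr.
  rewrite -/(dvdn _ _) ltnNge; case: leqP => [le_nk|lt_kn] /=; last first.
    by rewrite dvdn_mulr // dvdn_exp2l.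
  (* After cancelling [2 ^ n], the cofactor is odd and no positive power of 2 divides it. *)
  apply/negP; rewrite -(subnKC le_nk) -addnS expnD dvdn_pmul2l ?expn_gt0 //.
  by move/(dvdn_trans (dvdn_exp2l 2 (ltn0Sn _))); rewrite expn1 dvdn2 /= odd_double.
have tlE n s : tl (CodeSeq.code (n :: s)) = CodeSeq.code s.
  rewrite /tl hdE /= mulKn ?expn_gt0 // -addn1 -muln2 divnMDl //.
  by rewrite divn_small // addn0.
have getE v i : get v i = hd (iteri i (fun _ => tl) v).
  rewrite -[v]CodeSeq.decodeK get_code.
  elim: i (CodeSeq.decode v) => [|i IHi] [|n s] //.
  - by rewrite hdE.
  - by rewrite nth_nil [iteri _ _ _](_ : _ = 0) //=; elim: i {IHi} => //= i ->.
  rewrite [LHS]IHi; congr hd.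
  by elim: i {IHi} => /= [|i ->]; rewrite ?tlE.
have c_hd H : computable H -> computable (fun e => hd (H e)).
  by move=> cH; apply: computable_count => //; auto 6 with computable.
apply: (@computable_ext (fun e => hd (iteri (G e) (fun _ => tl) (F e)))) => [e|].
  by rewrite getE.
apply/c_hd/computable_iteri => //.
by apply: computable_div; auto with computable.
Qed.
#[local] Hint Resolve computable_get : computable.

Lemma computable_code_mkseq F N :
  computable N -> computable (fun e => F (behead e) (head 0 e)) ->
  computable (fun e => CodeSeq.code (mkseq (F e) (N e))).
Proof.
move=> cN cF.
pose G e k r := 2 ^ F e (N e - k.+1) * (r * 2).+1.
apply: (@computable_ext (fun e => iteri (N e) (G e) 0)) => [e|].
  (* The code is built from the end of the sequence: [k] iterations yield the code of the last [k]
     entries. *)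
  suff E k : k <= N e -> iteri k (G e) 0 =
      CodeSeq.code [seq F e i | i <- iota (N e - k) k].
    by rewrite E // subnn.
  elim: k => //= k IHk lt_kN; rewrite IHk 1?ltnW // /G -subSn // subSS.
  by rewrite muln2.
apply: computable_iteri; auto with computable.
rewrite /G; apply: computable_mul; last by auto with computable.
apply: computable_exp; first by auto with computable.
by apply: (computable_subst_head (P := F)) => //; auto with computable.
Qed.

Lemma computable_of_bool P : computableb P -> computable (fun e => nat_of_bool (P e)).
Proof. by []. Qed.

Lemma computable_code_nil : computable (fun => CodeSeq.code [::]).
Proof. exact: computable_const. Qed.

Lemma computable_code_cons F G : computable F ->
  computable (fun e => CodeSeq.code (G e)) ->
  computable (fun e => CodeSeq.code (F e :: G e)).
Proof.
move=> cF cG.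
apply: (@computable_ext (fun e => 2 ^ F e * (CodeSeq.code (G e) * 2).+1)) => [e|].
  by rewrite muln2.
by auto with computable.
Qed.

#[local] Hint Resolve computable_of_bool computable_code_nil computable_code_cons : computable.
#[local] Hint Resolve computableb_bit computableb_has computableb_all : computable.
#[local] Hint Resolve computable_code_mkseq : computable.

(** * Automata over the natural numbers *)

(* States and letters are numbers; the states are those below [states]. *)
Record automaton := Automaton {
  states : nat;
  initial : pred nat;
  final : pred nat;
  trans : nat -> nat -> nat -> bool
}.

Fixpoint run A p w :=
  if w is a :: w' then has (fun q => trans A p a q && run A q w') (iota 0 (states A))
  else final A p.

Definition accepts A w := has (fun p => initial A p && run A p w) (iota 0 (states A)).

Lemma has_iotaP (P : pred nat) n : reflect (exists2 k, k < n & P k) (has P (iota 0 n)).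
Proof. by apply: (iffP hasP) => -[k]; [rewrite mem_iota|]; exists k => //; rewrite mem_iota. Qed.

Lemma all_iotaP (P : pred nat) n : reflect (forall k, k < n -> P k) (all P (iota 0 n)).
Proof.
apply: (iffP allP) => allP k => [lt_kn|]; first by apply: allP; rewrite mem_iota.
by rewrite mem_iota; apply: allP.
Qed.

(** A pair of states [p] and [q] is numbered [p * states B + q]. *)
Definition inter A B := Automaton (states A * states B)
  (fun p => initial A (p %/ states B) && initial B (p %% states B))
  (fun p => final A (p %/ states B) && final B (p %% states B))
  (fun p a q => trans A (p %/ states B) a (q %/ states B)
             && trans B (p %% states B) a (q %% states B)).

Lemma has_iota_divmod (P Q : pred nat) m n :
  has (fun p => P (p %/ n) && Q (p %% n)) (iota 0 (m * n)) =
  has P (iota 0 m) && has Q (iota 0 n).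
Proof.
apply/has_iotaP/andP => [[p lt_p /andP[Pp Qp]]|[/has_iotaP[i lt_i Pi] /has_iotaP[j lt_j Qj]]].
  have n_gt0 : 0 < n by case: n lt_p {Pp Qp} => //; rewrite muln0.
  split; apply/has_iotaP; [exists (p %/ n) | exists (p %% n)] => //.
    by rewrite ltn_divLR.
  by rewrite ltn_mod.
have n_gt0 : 0 < n by apply: leq_trans lt_j.
exists (i * n + j); last by rewrite divnMDl // divn_small // addn0 Pi modnMDl modn_small.
by rewrite (leq_trans _ (_ : i.+1 * n <= _)) ?leq_mul2r ?lt_i ?orbT // mulSn addnC ltn_add2r.
Qed.

Lemma accepts_inter A B w : accepts (inter A B) w = accepts A w && accepts B w.
Proof.
have runE p : run (inter A B) p w = run A (p %/ states B) w && run B (p %% states B) w.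
  elim: w p => //= a w IHw p; rewrite -has_iota_divmod.
  by apply: eq_has => q; rewrite IHw andbACA.
rewrite /accepts -has_iota_divmod.
by apply: eq_has => q; rewrite runE andbACA.
Qed.

(* Subset construction: bit [q] of the state [E] tells whether [q] belongs to
   the set of states of [A] reachable on the prefix read so far. *)
Definition compl A := Automaton (2 ^ states A)
  (fun E => all (fun q => bit q E == initial A q) (iota 0 (states A)))
  (fun E => ~~ has (fun q => bit q E && final A q) (iota 0 (states A)))
  (fun E a E' => all (fun q' => bit q' E' ==
      has (fun q => bit q E && trans A q a q') (iota 0 (states A)))
    (iota 0 (states A))).

Lemma accepts_compl A w : accepts (compl A) w = ~~ accepts A w.
Proof.
(* Determinism of the subset construction: by [bit_surj] some state represents the set [P], and [f]
   has the same value on all representatives, so the search for a successor amounts to an evaluation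
   at [P]. *)
have has_set (P : pred nat) (f : pred nat) (g : nat -> bool) :
    (forall E, (forall q, q < states A -> bit q E = P q) ->
       f E = ~~ has (fun q => P q && g q) (iota 0 (states A))) ->
    has (fun E => all (fun q => bit q E == P q) (iota 0 (states A)) && f E)
      (iota 0 (2 ^ states A)) =
    ~~ has (fun q => P q && g q) (iota 0 (states A)).
  move=> fE; have [E0 lt_E0 E0P] := bit_surj (states A) P.
  apply/has_iotaP/idP => [[E _ /andP[/all_iotaP EP]]|nP].
    by rewrite fE // => q /EP/eqP.
  exists E0 => //; rewrite fE // nP andbT.
  by apply/all_iotaP => q /E0P->.
have runE E : run (compl A) E w =
    ~~ has (fun q => bit q E && run A q w) (iota 0 (states A)).
  elim: w E => //= a w IHw E.
  rewrite (has_set _ _ (run A ^~ w)) => [|E' E'P]; last first.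
    rewrite IHw; congr (~~ _); apply: eq_in_has => q.
    by rewrite mem_iota => /E'P->.
  congr (~~ _); apply/has_iotaP/has_iotaP.
    case=> q lt_q /andP[/has_iotaP[p lt_p /andP[pE tr] run_q]].
    by exists p => //; rewrite pE; apply/has_iotaP; exists q; rewrite ?tr.
  case=> p lt_p /andP[pE /has_iotaP[q lt_q /andP[tr run_q]]].
  by exists q; rewrite // run_q andbT; apply/has_iotaP; exists p; rewrite ?pE.
apply: has_set => E EP; rewrite runE; congr (~~ _); apply: eq_in_has => q.
by rewrite mem_iota => /EP->.
Qed.

Definition comap (h : nat -> nat) A := Automaton (states A) (initial A) (final A)
  (fun p a q => trans A p (h a) q).

Lemma accepts_comap h A w : accepts (comap h A) w = accepts A (map h w).
Proof.
apply: eq_has => p; congr (_ && _).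
by elim: w p => //= a w IHw p; apply: eq_has => q; rewrite IHw.
Qed.

(** Projections are relabellings in which [rho] forgets a component. The bound [K] on the guessed
    letter keeps the transition relation decidable. *)
Definition relab K (rho : rel nat) A := Automaton (states A) (initial A) (final A)
  (fun p z q => has (fun y => rho z y && trans A p y q) (iota 0 K)).

Lemma accepts_relabP K rho A z :
  reflect (exists y, [/\ all (ltn^~ K) y, all2 rho z y & accepts A y])
    (accepts (relab K rho A) z).
Proof.
have runP p : reflect (exists y, [/\ all (ltn^~ K) y, all2 rho z y & run A p y])
    (run (relab K rho A) p z).
  elim: z p => [|a z IHz] p.
    by apply: (iffP idP) => [fin_p|[[|b y] []]] //; exists [::].
  apply: (iffP (has_iotaP _ _)).
    case=> q lt_q /andP[/has_iotaP[b lt_b /andP[ab tr]] /IHz[y [yK zy run_y]]].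
    exists (b :: y); rewrite /= lt_b ab; split=> //.
    by apply/has_iotaP; exists q; rewrite ?tr.
  case=> -[|b y] [] //= /andP[lt_b yK] /andP[ab zy] /has_iotaP[q lt_q /andP[tr run_y]].
  exists q => //; apply/andP; split; last by apply/IHz; exists y.
  by apply/has_iotaP; exists b; rewrite ?ab.
apply: (iffP (has_iotaP _ _)) => [[p lt_p /andP[ini /runP[y [yK zy run_y]]]]|].
  by exists y; split=> //; apply/has_iotaP; exists p; rewrite ?ini.
case=> y [yK zy /has_iotaP[p lt_p /andP[ini run_y]]].
by exists p; rewrite // ini; apply/runP; exists y.
Qed.

(** * Computability of the automaton constructions *)

Definition automaton_code n A :=
  CodeSeq.code
    [:: states A;
        CodeSeq.code (mkseq (fun p => nat_of_bool (initial A p)) (states A));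
        CodeSeq.code (mkseq (fun p => nat_of_bool (final A p)) (states A));
        CodeSeq.code (mkseq (fun p => CodeSeq.code (mkseq (fun a =>
          CodeSeq.code (mkseq (fun q => nat_of_bool (trans A p a q)) (states A))) n))
          (states A))].

(** As [get] is total, every number decodes to some automaton, with no test for well-formedness. *)
Definition decode_automaton v := Automaton (get v 0)
  (fun p => get (get v 1) p == 1) (fun p => get (get v 2) p == 1)
  (fun p a q => get (get (get (get v 3) p) a) q == 1).

(** All arguments are computable functions of the environment, so that the components can be used
    under any number of bound variables. *)
Definition computable_automaton (A : nat -> nat -> automaton) : Prop :=
  [/\ forall c b, computable c -> computable b ->
        computable (fun e => states (A (c e) (b e))),
      forall c b p, computable c -> computable b -> computable p ->
        computableb (fun e => initial (A (c e) (b e)) (p e)),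
      forall c b p, computable c -> computable b -> computable p ->
        computableb (fun e => final (A (c e) (b e)) (p e))
    & forall c b p a q, computable c -> computable b ->
        computable p -> computable a -> computable q ->
        computableb (fun e => trans (A (c e) (b e)) (p e) (a e) (q e))].

Lemma computable_inter A B : computable_automaton A -> computable_automaton B ->
  computable_automaton (fun c b => inter (A c b) (B c b)).
Proof.
by case=> cA1 cA2 cA3 cA4 [cB1 cB2 cB3 cB4]; split=> * /=; auto 6 with computable.
Qed.

Lemma computable_compl A : computable_automaton A ->
  computable_automaton (fun c b => compl (A c b)).
Proof.
by case=> cA1 cA2 cA3 cA4; split=> * /=; auto 12 with computable.
Qed.

Lemma computable_comap h A : computable_automaton A ->
  (forall c b z, computable c -> computable b -> computable z ->
    computable (fun e => h (c e) (b e) (z e))) ->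
  computable_automaton (fun c b => comap (h c b) (A c b)).
Proof. by case=> cA1 cA2 cA3 cA4 ch; split=> * /=; auto with computable. Qed.

Lemma computable_relab K rho A : computable_automaton A ->
  (forall c b, computable c -> computable b -> computable (fun e => K (c e) (b e))) ->
  (forall c b z y, computable c -> computable b -> computable z -> computable y ->
    computableb (fun e => rho (c e) (b e) (z e) (y e))) ->
  computable_automaton (fun c b => relab (K c b) (rho c b) (A c b)).
Proof. by case=> cA1 cA2 cA3 cA4 cK crho; split=> * /=; auto 12 with computable. Qed.

Lemma computable_decode_automaton g :
  (forall c b, computable c -> computable b -> computable (fun e => g (c e) (b e))) ->
  computable_automaton (fun c b => decode_automaton (g c b)).
Proof. by move=> cg; split=> * /=; auto 12 with computable. Qed.

Lemma computable_automaton_code n A : computable_automaton A ->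
  (forall c b, computable c -> computable b -> computable (fun e => n (c e) (b e))) ->
  forall c b, computable c -> computable b ->
    computable (fun e => automaton_code (n (c e) (b e)) (A (c e) (b e))).
Proof.
case=> cA1 cA2 cA3 cA4 cn c b cc cb; rewrite /automaton_code.
by auto 20 with computable.
Qed.

(** * Goedel numbers of automata *)

Definition rank (T : finType) (x : T) : nat := index x (enum T).

Lemma ltn_rank (T : finType) (x : T) : rank x < #|T|.
Proof. by rewrite cardE index_mem mem_enum. Qed.

Lemma nth_rank (T : finType) (x0 x : T) : nth x0 (enum T) (rank x) = x.
Proof. by rewrite nth_index ?mem_enum. Qed.

Lemma rank_inj (T : finType) : injective (@rank T).
Proof. by move=> x y eq_xy; rewrite -[x](nth_rank x) eq_xy nth_rank. Qed.

Lemma rank_surj (T : finType) i : i < #|T| -> exists x : T, rank x = i.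
Proof.
rewrite cardE => lt_i; case Dx: (enum T) (lt_i) => [|x0 s] //; rewrite -Dx => _.
by exists (nth x0 (enum T) i); rewrite /rank index_uniq ?enum_uniq.
Qed.

Lemma map_rank_enum (T : finType) : map (@rank T) (enum T) = iota 0 #|T|.
Proof.
apply: (@eq_from_nth _ 0); rewrite size_map -cardE ?size_iota // => i lt_i.
have [x <-] := rank_surj lt_i.
by rewrite nth_iota ?ltn_rank // (nth_map x) ?nth_rank // -cardE ltn_rank.
Qed.

Lemma nth_map_rank (T : finType) S (s0 : S) (f : T -> S) x :
  nth s0 [seq f y | y <- enum T] (rank x) = f x.
Proof. by rewrite (nth_map x) ?nth_rank // -cardE ltn_rank. Qed.

(** The enumeration of a product consists of one block of length [#|T|] for each [x], in the order
    of [enum S]. *)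
Lemma rank_pair (S T : finType) (x : S) (y : T) :
  rank (x, y) = rank x * #|T| + rank y.
Proof.
have -> : rank (x, y) = index (x, y) [seq (x, y) | x <- enum S, y <- enum T].
  by rewrite /rank enumT unlock.
rewrite /rank [#|T|]cardE; have: x \in enum S by rewrite mem_enum.
elim: (enum S) => //= z s IHs; rewrite inE index_cat.
have inj_pair u : injective (pair u : T -> S * T) by move=> ? ? [].
case: eqVneq => [<- _|neq_xz /= /IHs->].
  by rewrite (mem_map (inj_pair x)) mem_enum inE (index_map (inj_pair x)).
rewrite ifN; last by apply: contra neq_xz => /mapP[? _ [-> _]].
by rewrite size_map mulSn addnA.
Qed.

Lemma has_iota_rank (T : finType) (P : pred nat) :
  has P (iota 0 #|T|) = [exists x : T, P (rank x)].
Proof.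
apply/has_iotaP/existsP => [[k /rank_surj[x <-]]|[x Px]]; first by exists x.
by exists (rank x); rewrite ?ltn_rank.
Qed.

(** Decoding gives back [M] with its states renamed to their ranks, and these are exactly the
    numbers below the number of states. *)
Lemma accepts_nfa_code (T : finType) (M : nfa T) w :
  accepts (decode_automaton (nfa_code M)) (map (@rank T) w) = nfa_accepts M w.
Proof.
have bitE (S : finType) (P : pred S) x : (get (code_bits P) (rank x) == 1) = P x.
  by rewrite /code_bits get_code nth_map_rank; case: (P x).
set A := decode_automaton _.
have statesE : states A = #|nfa_state M| by rewrite [LHS]get_code.
have initialE p : initial A (rank p) = (p \in nfa_init M).
  by rewrite -[RHS](bitE _ (mem (nfa_init M))); congr (get _ _ == 1); exact: get_code.
have finalE p : final A (rank p) = (p \in nfa_final M).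
  by rewrite -[RHS](bitE _ (mem (nfa_final M))); congr (get _ _ == 1); exact: get_code.
have transE (p : nfa_state M) (a : T) q : trans A (rank p) (rank a) (rank q) = nfa_trans p a q.
  rewrite -[RHS](bitE _ (nfa_trans p a)); congr (get _ _ == 1).
  have -> : get (nfa_code M) 3 = CodeSeq.code
      [seq CodeSeq.code [seq code_bits (nfa_trans p a) | a <- enum T]
      | p <- enum (nfa_state M)] by exact: get_code.
  by rewrite !(get_code, nth_map_rank).
clearbody A; have runE (p : nfa_state M) : run A (rank p) (map (@rank T) w) = nfa_run p w.
  elim: w p => [|a w IHw] p; first exact: finalE.
  rewrite /= statesE has_iota_rank; apply: eq_existsb => q.
  by rewrite IHw transE.
rewrite /accepts statesE has_iota_rank; apply: eq_existsb => p.
by rewrite runE initialE.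
Qed.

Definition nfa_of_automaton (T : finType) (A : automaton) : nfa T :=
  @Nfa T 'I_(states A) [set p : 'I_(states A) | initial A p]
    [set p : 'I_(states A) | final A p]
    (fun (p : 'I_(states A)) a (q : 'I_(states A)) => trans A p (rank a) q).

Lemma nfa_of_automatonE (T : finType) A w :
  nfa_accepts (nfa_of_automaton T A) w = accepts A (map (@rank T) w).
Proof.
have has_ord n (P : pred nat) : has P (iota 0 n) = [exists p : 'I_n, P p].
  apply/has_iotaP/existsP => [[k lt_k Pk]|[k Pk]]; last by exists k.
  by exists (Ordinal lt_k).
rewrite /accepts has_ord; apply: eq_existsb => p; rewrite inE; congr (_ && _).
elim: w p => [|a w IHw] p /=; first by rewrite inE.
by rewrite has_ord; apply: eq_existsb => q; rewrite -IHw.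
Qed.

(** The codes agree exactly because ordinals are enumerated in increasing order and letters by rank,
    so every table is a [mkseq]. *)
Lemma nfa_code_of_automaton (T : finType) A :
  nfa_code (nfa_of_automaton T A) = automaton_code #|T| A.
Proof.
have map_ord S n (f : nat -> S) : [seq f p | p : 'I_n] = mkseq f n.
  by rewrite /mkseq -val_enum_ord -map_comp.
have map_rank S (f : nat -> S) : [seq f (rank a) | a : T] = mkseq f #|T|.
  by rewrite /mkseq -map_rank_enum -map_comp.
rewrite /nfa_code /automaton_code /code_bits card_ord.
congr (CodeSeq.code [:: _; CodeSeq.code _; CodeSeq.code _; CodeSeq.code _]).
- by rewrite -map_ord; apply: eq_map => p; rewrite /= inE.
- by rewrite -map_ord; apply: eq_map => p; rewrite /= inE.
rewrite -map_ord; apply: eq_map => p; congr CodeSeq.code.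
rewrite -map_rank; apply: eq_map => a; congr CodeSeq.code.
by rewrite -map_ord.
Qed.

(** * Formulas as words *)

(* The configuration [u] is given by the ranks of its letters. Bit [i * n + q] of
   the [j]-th item of [X] tells whether the proposition that the [j]-th letter is
   [q] belongs to the [i]-th clause. *)
Definition satisfies n b (u X : seq nat) :=
  all (fun i => has (fun p => bit (i * n + p.1) p.2) (zip u X)) (iota 0 b).

Definition inductive_word (T : finType) (R : rts T) b (X : seq nat) : Prop :=
  forall u w, size u = size X -> rts_step R u w ->
    satisfies #|T| b (map (@rank T) u) X -> satisfies #|T| b (map (@rank T) w) X.

Lemma onth_some (T : Type) (x0 : T) s j : j < size s -> onth s j = Some (nth x0 s j).
Proof. by move=> lt_j; rewrite onthE (nth_map x0). Qed.

Lemma onth_exists (T : Type) (s : seq T) j : j < size s -> exists x, onth s j = Some x.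
Proof. by rewrite -onthTE; case: (onth s j) => // x; exists x. Qed.

Lemma satisfiesP (T : finType) b (w : seq T) X : size w = size X ->
  reflect (forall i, i < b -> exists2 j, j < size X &
             exists2 q, onth w j = Some q & bit (i * #|T| + rank q) (nth 0 X j))
    (satisfies #|T| b (map (@rank T) w) X).
Proof.
move=> sz; apply: (iffP (all_iotaP _ _)) => satX i lt_ib.
  have /(has_nthP (0, 0))[j] := satX i lt_ib.
  rewrite size_zip size_map sz minnn nth_zip ?size_map //= => lt_j bit_j.
  exists j => //; case: w sz bit_j {satX} => [|x w] sz bit_j; first by rewrite -sz in lt_j.
  exists (nth x (x :: w) j); first by rewrite (onth_some x) // sz.
  by rewrite (nth_map x) // sz in bit_j.
have [j lt_j [q wj bit_j]] := satX i lt_ib.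
apply/(has_nthP (0, 0)); exists j; first by rewrite size_zip size_map sz minnn.
rewrite nth_zip ?size_map //= (nth_map q) ?sz //.
by rewrite (onth_nth q _ _ _ wj).
Qed.

Lemma seq_choice (P : nat -> nat -> Prop) l :
  (forall j, j < l -> exists k, P j k) ->
  exists2 X, size X = l & forall j, j < l -> P j (nth 0 X j).
Proof.
elim: l => [|l IHl] exP; first by exists [::].
have [j /ltnW/exP//|X szX PX] := IHl; have [k Pk] := exP l (ltnSn l).
exists (rcons X k) => [|j]; first by rewrite size_rcons szX.
rewrite nth_rcons szX ltnS leq_eqVlt => /predU1P[->|lt_jl]; first by rewrite ltnn eqxx.
by rewrite lt_jl; apply: PX.
Qed.

(** Words have no constants, so a true constant counts as all propositions at once and a false one
    as none. *)
Definition literal_at (T : finType) l (q j : nat) (x : literal T l) : bool :=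
  match x with Atom q' j' => (q == rank q') && (j == j') | Const c => c end.

Lemma has_sat_literal (T : finType) l (c : clause T l) w : 0 < l -> size w = l ->
  has (sat_literal w) c <->
  exists2 j, j < l & exists2 q, onth w j = Some q & has (literal_at (rank q) j) c.
Proof.
move=> l_gt0 szw; elim: c => [|x c IHc] /=; first by split=> // -[j _ [q]].
split=> [/orP[|/IHc[j lt_j [q wj cq]]]|[j lt_j [q wj /orP[xq|cq]]]].
- case: x => [q j /eqP wj|[] // _].
    by exists j => //; exists q; rewrite //= !eqxx.
  (* The literal is the constant true; position 0, available since [0 < l], witnesses it. *)
  have [|q wj] := @onth_exists T w 0; first by rewrite szw.
  by exists 0 => //; exists q.
- by exists j => //; exists q; rewrite // cq orbT.
- case: x xq => [q' j' /= /andP[/eqP/rank_inj <- /eqP<-]|[] //].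
  by rewrite wj eqxx.
by apply/orP; right; apply/IHc; exists j => //; exists q.
Qed.

(* A constant true clause holds at every position, so it needs a position. *)
Lemma word_of_formula (T : finType) b l (phi : formula T l) :
  0 < l -> size phi <= b ->
  exists X, [/\ size X = l, all (fun E => E < 2 ^ (b * #|T|)) X
    & forall w, size w = l -> satisfies #|T| b (map (@rank T) w) X = sat phi w].
Proof.
move=> l_gt0 le_phi; set n := #|T|.
(* Here [k] stands for [i * n + q]. The clauses missing between [size phi] and [b] are padded with
   all propositions, hence true. *)
pose P j k := (k %/ n < size phi) ==> has (literal_at (k %% n) j) (nth [::] phi (k %/ n)).
have [j _|X szX PX] :=
    @seq_choice (fun j E => E < 2 ^ (b * n) /\ forall k, k < b * n -> bit k E = P j k) l.
  by have [E ltE EP] := bit_surj (b * n) (P j); exists E.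
exists X; split=> // [|w szw].
  by apply/(all_nthP 0) => j; rewrite szX => /PX[].
have bitX i j (q : T) : i < b -> j < l ->
    bit (i * n + rank q) (nth 0 X j) =
    (i < size phi) ==> has (literal_at (rank q) j) (nth [::] phi i).
  move=> lt_i lt_j; have n_gt0 : 0 < n by apply: leq_ltn_trans (ltn_rank q).
  have [_ ->] := PX j lt_j.
    by rewrite /P divnMDl // divn_small ?ltn_rank // addn0 modnMDl modn_small ?ltn_rank.
  by rewrite (leq_trans _ (_ : i.+1 * n <= _)) ?leq_mul2r ?lt_i ?orbT // mulSn addnC
             ltn_add2r ltn_rank.
rewrite /sat szw eqxx /=.
apply/(satisfiesP _ (etrans szw (esym szX)))/(all_nthP [::]) => [satX i lt_i|sat_phi i lt_i].
  apply/(has_sat_literal _ l_gt0 szw).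
  have [j] := satX i (leq_trans lt_i le_phi); rewrite szX => lt_j [q wj].
  rewrite bitX ?(leq_trans lt_i le_phi) // lt_i => cq.
  by exists j => //; exists q.
rewrite szX; case: (ltnP i (size phi)) => [lt_i_phi|le_phi_i].
  have /(has_sat_literal _ l_gt0 szw)[j lt_j [q wj cq]] := sat_phi i lt_i_phi.
  by exists j => //; exists q; rewrite // bitX // cq implybT.
have [|q wj] := @onth_exists T w 0; first by rewrite szw.
by exists 0 => //; exists q; rewrite // bitX // ltnNge le_phi_i.
Qed.

Lemma formula_of_word (T : finType) b X :
  exists2 phi : formula T (size X), size phi = b
    & forall w, size w = size X -> satisfies #|T| b (map (@rank T) w) X = sat phi w.
Proof.
pose P i (p : T * 'I_(size X)) := bit (i * #|T| + rank p.1) (nth 0 X p.2).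
exists [seq [seq Atom p.1 p.2 | p <- enum {: T * 'I_(size X)} & P i p] | i <- iota 0 b].
  by rewrite size_map size_iota.
move=> w szw; rewrite /sat szw eqxx all_map.
apply/(satisfiesP _ szw)/all_iotaP => satX i /satX.
  case=> j lt_j [q wj bit_j] /=; rewrite has_map; apply/hasP.
  exists (q, Ordinal lt_j); last by rewrite /= wj.
  by rewrite mem_filter mem_enum andbT.
rewrite /= has_map => /hasP[[q j]]; rewrite mem_filter => /andP[bit_j _] /= /eqP wj.
by exists j => //; exists q.
Qed.

Lemma sat_other_size (T : finType) l (phi : formula T l) w : size w != l -> sat phi w.
Proof. by rewrite /sat => /negPf->. Qed.

(** Steps preserve length, and configurations of any other length satisfy [phi]; only those of
    length [size X] matter. *)
Lemma inductive_wordP (T : finType) (R : rts T) b X (phi : formula T (size X)) :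
  (forall w, size w = size X -> satisfies #|T| b (map (@rank T) w) X = sat phi w) ->
  inductive_word R b X <-> inductive_formula R phi.
Proof.
move=> satE; split=> ind u w; last first.
  move=> szu Ruw; have szw : size w = size X by case/andP: Ruw => /eqP <-.
  by rewrite !satE // => /ind; apply.
case: (eqVneq (size w) (size X)) => [szw sat_u Ruw|/sat_other_size-> //].
have szu : size u = size X by case/andP: Ruw => /eqP ->.
by rewrite -satE //; apply: ind Ruw _ => //; rewrite satE.
Qed.

Lemma potentially_reachableP (T : finType) (R : rts T) b u w : 1 <= b ->
  potentially_reachable R b u w <->
  size u = size w /\ forall X, size X = size u -> all (fun E => E < 2 ^ (b * #|T|)) X ->
    inductive_word R b X -> satisfies #|T| b (map (@rank T) u) X ->
    satisfies #|T| b (map (@rank T) w) X.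
Proof.
move=> b_gt0; split=> [reach|[szuw reach] l phi le_phi ind sat_u].
  have szuw : size u = size w.
    apply/eqP/negPn/negP => neq_uw.
    (* The formula false over the length of [w] is inductive, holds exactly at the other lengths,
       and has one clause, whence [1 <= b]. *)
    pose phi : formula T (size w) := [:: [::]].
    have satE x : sat phi x = (size x != size w).
      by rewrite /sat /=; case: eqP.
    suff : sat phi w by rewrite satE eqxx.
    apply: reach; rewrite ?satE // => x y; rewrite !satE => neq_xw.
    by case/andP=> /eqP <-.
  split=> // X szX _ ind; have [phi szphi satE] := formula_of_word T b X.
  rewrite !satE -?szuw //; apply: reach; first by rewrite szphi.
  exact/(inductive_wordP R satE).
case: (eqVneq (size w) l) => [szw|/sat_other_size-> //].
(* Length 0, which [word_of_formula] excludes, is treated directly: both configurations are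
   empty. *)
case: (posnP l) => [l0|l_gt0].
  have w0 : w = [::] by apply: size0nil; rewrite szw.
  have u0 : u = [::] by apply: size0nil; rewrite szuw szw.
  by rewrite w0 -u0.
have [X [szX ltX satE]] := word_of_formula l_gt0 le_phi.
rewrite -satE //; apply: reach => //; first by rewrite szX szuw.
  move: szX phi ind {le_phi sat_u ltX szw l_gt0} satE => <- phi ind satE.
  exact/(inductive_wordP R satE).
by rewrite satE // szuw.
Qed.

(** * The automaton for IndInv_b *)

(* A letter packs letters [x] and [y] of two configurations, in this order, with
   the set [E] of pairs (clause, letter) put by a formula at their position. *)
Definition letter n x y E := (E * n + y) * n + x.
Definition upper n z := z %% n.
Definition lower n z := z %/ n %% n.
Definition column n z := z %/ n %/ n.
Definition letters n b := 2 ^ (b * n) * n * n.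

Lemma column_lt n b z : z < letters n b -> column n z < 2 ^ (b * n).
Proof.
case: n => [|n]; first by rewrite /letters muln0.
by rewrite /letters /column !ltn_divLR.
Qed.

Lemma letterK n x y E : x < n -> y < n ->
  [/\ upper n (letter n x y E) = x, lower n (letter n x y E) = y
    & column n (letter n x y E) = E].
Proof.
move=> lt_x lt_y; have n_gt0 : 0 < n by apply: leq_ltn_trans lt_x.
rewrite /upper /lower /column /letter modnMDl modn_small // divnMDl // (divn_small lt_x).
by rewrite addn0 modnMDl modn_small // divnMDl // (divn_small lt_y) addn0.
Qed.

Lemma letter_lt n b x y E : x < n -> y < n -> E < 2 ^ (b * n) ->
  letter n x y E < letters n b.
Proof.
have step k a m : a < m -> k < n -> a * n + k < m * n.
  move=> lt_a lt_k; apply: leq_trans (_ : a.+1 * n <= _); last by rewrite leq_mul2r lt_a orbT.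
  by rewrite mulSn addnC ltn_add2r.
by move=> lt_x lt_y lt_E; apply: (step) => //; apply: step.
Qed.

Lemma split_word (T : finType) b Z : all (fun z => z < letters #|T| b) Z ->
  exists u w : seq T, [/\ map (upper #|T|) Z = map (@rank T) u,
    map (lower #|T|) Z = map (@rank T) w
    & all (fun E => E < 2 ^ (b * #|T|)) (map (column #|T|) Z)].
Proof.
elim: Z => [|z Z IHZ] /=; first by exists [::], [::].
case/andP=> lt_z /IHZ[u [w [-> -> ->]]] {IHZ}.
have n_gt0 : 0 < #|T| by case: #|T| lt_z => //; rewrite /letters muln0.
have [x xE] := rank_surj (ltn_pmod z n_gt0).
have [y yE] := rank_surj (ltn_pmod (z %/ #|T|) n_gt0).
by exists (x :: u), (y :: w); rewrite /= xE yE column_lt.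
Qed.

Lemma merge_word (T : finType) b (u w : seq T) X :
  size u = size X -> size w = size X -> all (fun E => E < 2 ^ (b * #|T|)) X ->
  exists Z, [/\ all (fun z => z < letters #|T| b) Z, map (upper #|T|) Z = map (@rank T) u,
    map (lower #|T|) Z = map (@rank T) w & map (column #|T|) Z = X].
Proof.
elim: X u w => [|E X IHX] [|x u] [|y w] //=; first by exists [::].
move=> [szu] [szw] /andP[lt_E /(IHX u w szu szw)[Z [ltZ uZ wZ XZ]]].
have [xE yE EE] := letterK E (ltn_rank x) (ltn_rank y).
exists (letter #|T| (rank x) (rank y) E :: Z).
by rewrite /= letter_lt ?ltn_rank //= ltZ uZ wZ XZ xE yE EE.
Qed.

(* The state is the guessed clause, which no letter may satisfy. *)
Definition unsat_automaton n b (g : nat -> nat) := Automaton b xpredT xpredT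
  (fun i z j => (i == j) && ~~ bit (i * n + g z) (column n z)).

Lemma accepts_unsat n b g Z :
  accepts (unsat_automaton n b g) Z = ~~ satisfies n b (map g Z) (map (column n) Z).
Proof.
have runE i : i < b -> run (unsat_automaton n b g) i Z =
    all (fun z => ~~ bit (i * n + g z) (column n z)) Z.
  move=> lt_i; elim: Z => // z Z IHZ; rewrite [RHS]/= -IHZ.
  apply/has_iotaP/andP => [[j _ /andP[/andP[/eqP <- ?] ?]]|[bit_z run_Z]] //.
  by exists i; rewrite //= eqxx bit_z.
rewrite /satisfies -has_predC; apply: eq_in_has => i; rewrite mem_iota => lt_i.
by rewrite runE //= zip_map has_map -all_predC.
Qed.

Lemma all2_eq_map (f g : nat -> nat) s t :
  all2 (fun x y => f x == g y) s t = (map f s == map g t).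
Proof.
elim: s t => [|x s IHs] [|y t] //=.
by rewrite IHs eqseq_cons.
Qed.

(** By [rank_pair], the letter handed to the transducer is the rank of a pair. *)
Definition step_automaton n v :=
  comap (fun z => upper n z * n + lower n z) (decode_automaton v).

(** Only the column of the input letter is kept. A step from a configuration satisfying the formula
    to one violating it is guessed. *)
Definition noninductive_automaton n b v :=
  relab (letters n b) (fun z y => column n z == column n y)
    (inter (step_automaton n v) (inter (compl (unsat_automaton n b (upper n)))
                                     (unsat_automaton n b (lower n)))).

(** Here both configurations are kept and the column of a separating inductive formula is
    guessed. *)
Definition unreachable_automaton n b v :=
  relab (letters n b) (fun z y => (upper n z == upper n y) && (lower n z == lower n y))
    (inter (compl (noninductive_automaton n b v))
           (inter (compl (unsat_automaton n b (upper n))) (unsat_automaton n b (lower n)))).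

(** The input is the lower configuration; the upper one is guessed among the initial
    configurations. *)
Definition indinv_automaton n b vi v :=
  relab (letters n b) (fun a y => a == lower n y)
    (inter (comap (upper n) (decode_automaton vi)) (compl (unreachable_automaton n b v))).

Lemma accepts_step (T : finType) (R : rts T) Z u w :
  map (upper #|T|) Z = map (@rank T) u -> map (lower #|T|) Z = map (@rank T) w ->
  accepts (step_automaton #|T| (nfa_code (rts_trans R))) Z = rts_step R u w.
Proof.
move=> uZ wZ; have szu : size u = size Z by rewrite -(size_map (@rank T)) -uZ size_map.
have szw : size w = size Z by rewrite -(size_map (@rank T)) -wZ size_map.
rewrite /rts_step szu szw eqxx accepts_comap -accepts_nfa_code; congr (accepts _ _).
elim: Z u w uZ wZ {szu szw} => [|z Z IHZ] [|x u] [|y w] //= [-> uZ] [-> wZ].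
by rewrite (IHZ u w) // rank_pair.
Qed.

(** The bound on the columns ensures that a counterexample to inductiveness packs into letters below
    [letters], the range of the guess. *)
Lemma accepts_noninductive (T : finType) (R : rts T) b Z :
  all (fun E => E < 2 ^ (b * #|T|)) (map (column #|T|) Z) ->
  ~~ accepts (noninductive_automaton #|T| b (nfa_code (rts_trans R))) Z <->
  inductive_word R b (map (column #|T|) Z).
Proof.
move=> ltZ; split=> [nacc u w szu Ruw sat_u|ind].
  have szw : size w = size (map (column #|T|) Z) by case/andP: Ruw => /eqP <-.
  have [Y [ltY uY wY XY]] := merge_word szu szw ltZ.
  apply/negPn/negP => unsat_w; case/negP: nacc; apply/accepts_relabP; exists Y.
  split=> //; first by rewrite all2_eq_map XY.
  rewrite !accepts_inter accepts_compl !accepts_unsat negbK.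
  by rewrite (accepts_step R uY wY) uY wY XY Ruw sat_u.
apply/negP => /accepts_relabP[Y [ltY]].
rewrite all2_eq_map => /eqP XY.
rewrite !accepts_inter accepts_compl !accepts_unsat negbK -XY.
have [u [w [uY wY _]]] := split_word ltY.
rewrite (accepts_step R uY wY) uY wY => /and3P[Ruw sat_u /negP[]].
apply: ind Ruw sat_u.
by rewrite -(size_map (@rank T)) -uY XY !size_map.
Qed.

Lemma all2_and (r s : rel nat) x y :
  all2 (fun a b => r a b && s a b) x y = all2 r x y && all2 s x y.
Proof. by elim: x y => [|a x IHx] [|b y] //=; rewrite IHx andbACA. Qed.

Lemma accepts_unreachable (T : finType) (R : rts T) b Z u w : 1 <= b ->
  map (upper #|T|) Z = map (@rank T) u -> map (lower #|T|) Z = map (@rank T) w ->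
  ~~ accepts (unreachable_automaton #|T| b (nfa_code (rts_trans R))) Z <->
  potentially_reachable R b u w.
Proof.
move=> b_gt0 uZ wZ; apply: iff_trans (iff_sym (potentially_reachableP R u w b_gt0)).
have szu : size u = size Z by rewrite -(size_map (@rank T)) -uZ size_map.
have szw : size w = size Z by rewrite -(size_map (@rank T)) -wZ size_map.
split=> [nacc|[_ reach]].
  split=> [|X szX ltX ind sat_u]; first by rewrite szu szw.
  have [|||Y [ltY uY wY XY]] := @merge_word T b u w X; rewrite ?szX ?szu ?szw //.
  apply/negPn/negP => unsat_w; case/negP: nacc; apply/accepts_relabP; exists Y.
  rewrite all2_and !all2_eq_map uZ wZ uY wY !eqxx; split=> //.
  rewrite !accepts_inter !accepts_compl !accepts_unsat negbK uY wY XY sat_u unsat_w !andbT.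
  by apply/accepts_noninductive; rewrite XY.
apply/negP => /accepts_relabP[Y [ltY]].
rewrite all2_and !all2_eq_map uZ wZ => /andP[/eqP uY /eqP wY].
rewrite !accepts_inter !accepts_compl !accepts_unsat negbK -uY -wY.
have [_ [_ [_ _ ltX]]] := split_word ltY.
case/and3P=> /(accepts_noninductive _ ltX) ind sat_u /negP[]; apply: reach => //.
by rewrite size_map -(size_map (upper #|T|)) -uY size_map.
Qed.

Lemma accepts_indinv (T : finType) (R : rts T) b w : 1 <= b ->
  accepts (indinv_automaton #|T| b (nfa_code (rts_init R)) (nfa_code (rts_trans R)))
    (map (@rank T) w) <-> IndInv R b w.
Proof.
move=> b_gt0; split=> [/accepts_relabP[Z [ltZ]]|[u [init_u reach]]].
  have [u [w' [uZ wZ _]]] := split_word ltZ.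
  rewrite (all2_eq_map id) map_id wZ => /eqP/(inj_map (@rank_inj T)) ww'.
  rewrite accepts_inter accepts_comap accepts_compl uZ accepts_nfa_code => /andP[init_u].
  by move/(accepts_unreachable R b_gt0 uZ wZ); rewrite -ww'; exists u.
have [szuw _] := (potentially_reachableP R u w b_gt0).1 reach.
(* Any bounded column would do, since [unreachable_automaton] guesses its own; 0 is chosen. *)
have [|||Z [ltZ uZ wZ _]] := @merge_word T b u w (nseq (size u) 0).
- by rewrite size_nseq.
- by rewrite size_nseq.
- by rewrite all_nseq expn_gt0 orbT.
apply/accepts_relabP; exists Z; split=> //.
  by rewrite (all2_eq_map id) map_id wZ.
rewrite accepts_inter accepts_comap accepts_compl uZ accepts_nfa_code init_u.
exact/(accepts_unreachable R b_gt0 uZ wZ).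
Qed.

(** * Computability of the automaton for the inductive invariants *)

Lemma computableb_const P : computableb (fun => P).
Proof. exact: computable_const. Qed.
#[local] Hint Resolve computableb_const : computable.

Lemma computable_unsat_automaton n g :
  (forall c b, computable c -> computable b -> computable (fun e => n (c e) (b e))) ->
  (forall c b z, computable c -> computable b -> computable z ->
    computable (fun e => g (c e) (b e) (z e))) ->
  computable_automaton (fun c b => unsat_automaton (n c b) b (g c b)).
Proof.
move=> cn cg; split=> * /=; rewrite /column; auto 12 with computable.
Qed.

(** Here [c] is meant as an [rts_code]: its entries 0, 1 and 2 are the size of the alphabet, the
    code of the initial automaton and that of the transducer. *)
Lemma computable_indinv_automaton :
  computable_automaton (fun c b => indinv_automaton (get c 0) b (get c 1) (get c 2)).
Proof.
have c_unsat g cg := @computable_unsat_automaton (fun c _ => get c 0) g _ cg.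
have c_upper c z : computable c -> computable z ->
    computable (fun e => upper (get (c e) 0) (z e)).
  by move=> *; rewrite /upper; auto with computable.
have c_lower c z : computable c -> computable z ->
    computable (fun e => lower (get (c e) 0) (z e)).
  by move=> *; rewrite /lower; auto with computable.
have c_letters c b : computable c -> computable b ->
  computable (fun e => letters (get (c e) 0) (b e)).
  by move=> *; rewrite /letters; auto 6 with computable.
have c_sat_unsat : computable_automaton (fun c b =>
    inter (compl (unsat_automaton (get c 0) b (upper (get c 0))))
          (unsat_automaton (get c 0) b (lower (get c 0)))).
  apply: computable_inter; last by apply: c_unsat => *; auto with computable.
  by apply: computable_compl; apply: c_unsat => *; auto with computable.
have c_nonind : computable_automaton (fun c b => noninductive_automaton (get c 0) b (get c 2)).
  apply: computable_relab => // [|*]; last by rewrite /column; auto 6 with computable.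
  apply: computable_inter c_sat_unsat.
  apply: computable_comap => *; last by auto with computable.
  by apply: computable_decode_automaton => *; auto with computable.
apply: computable_relab => // [|*]; last by auto with computable.
apply: computable_inter.
  apply: computable_comap => *; last by auto with computable.
  by apply: computable_decode_automaton => *; auto with computable.
apply: computable_compl.
apply: computable_relab => // [|*]; last by auto 6 with computable.
by apply: computable_inter c_sat_unsat; apply: computable_compl.
Qed.

Theorem mainTheorem2 :
  exists f : 2.-tuple nat -> nat,
    recursive f /\
    forall (Sigma : finType) (R : rts Sigma) (b : nat), 1 <= b ->
      exists M : nfa Sigma,
        f [tuple rts_code R; b] = nfa_code M /\
        forall w : seq Sigma, nfa_accepts M w <-> IndInv R b w.
Proof.
pose A c b := indinv_automaton (get c 0) b (get c 1) (get c 2).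
exists (fun v => automaton_code (get (nth 0 v 0) 0) (A (nth 0 v 0) (nth 0 v 1))).
split=> [|Sigma R b b_gt0].
  have cA : computable_automaton A.
    exact: computable_indinv_automaton.
  have cn c b : computable c -> computable b -> computable (fun e => get (c e) 0).
    by auto with computable.
  (* Computability at all arities is used at arity 2, the variables being the Goedel number and
     [b]. *)
  exact: (@computable_automaton_code (fun c _ => get c 0) A cA cn _ _
    (computable_nth 0) (computable_nth 1) 2).
exists (nfa_of_automaton Sigma
  (indinv_automaton #|Sigma| b (nfa_code (rts_init R)) (nfa_code (rts_trans R)))).
split=> [|w]; last by rewrite nfa_of_automatonE; apply: accepts_indinv.
by rewrite nfa_code_of_automaton /A /= !get_code.
Qed.
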